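(* The $2$-partition mechanism is $3/8$-optimal on $\mathcal{G}^+$, the class of finite loopless directed graphs in which every vertex has outdegree at least $1$. That is, for every $G\in\mathcal{G}^+$ with $\Delta(G)>0$, the vertex $i$ selected from $G$ by the $2$-partition mechanism satisfies $\mathbb{E}[\delta^-(i,G)]\ge\frac38\,\Delta(G)$.
   Context: Graphs are finite directed graphs $G=(N,E)$ with vertex set $N=\{1,\dots,n\}$, $n\ge 1$, and $E\subseteq\{(i,j)\in N\times N: i\ne j\}$. For $S\subseteq N$ and $i\in N$, $\delta^-_S(i)=|\{j\in S:(j,i)\in E\}|$ is the indegree of $i$ from $S$; $\delta^-(i,G)=\delta^-_N(i)$; and $\Delta(G)=\max_{i\in N}\delta^-(i,G)$. $\mathcal{G}^+$ is the set of all such graphs in which every vertex has at least one outgoing edge. $2$-partition mechanism. On input $G=(N,E)$: assign each $i\in N$ independently and uniformly at random to one of two sets $A_1$ and $A_2$. If $A_2=\emptyset$, return a vertex chosen uniformly at random from $N$. Otherwise return a vertex chosen uniformly at random from $\arg\max_{i\in A_2}\delta^-_{A_1}(i)$. *)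

(* Defs.v *)
From HB Require Import structures.
From mathcomp Require Import all_boot all_order all_algebra.

Set Implicit Arguments.
Unset Strict Implicit.
Unset Printing Implicit Defensive.

Import Order.TTheory GRing.Theory Num.Theory.
Local Open Scope ring_scope.

(* The vertex set {1, ..., n} is encoded as 'I_n; (j, i) \in edges G is an
   edge from j to i. *)
Record digraph (n : nat) := Digraph {
  edges : {set 'I_n * 'I_n};
  loopless : forall i : 'I_n, (i, i) \notin edges
}.

Section Degrees.
Variables (n : nat) (G : digraph n).

Definition indeg_from (S : {set 'I_n}) (i : 'I_n) : nat :=
  #|[set j in S | (j, i) \in edges G]|.

Definition indeg (i : 'I_n) : nat := indeg_from [set: 'I_n] i.

Definition max_indeg : nat := \max_(i < n) indeg i.

Definition argmax_indeg (A1 A2 : {set 'I_n}) : {set 'I_n} :=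
  [set i in A2 | [forall j in A2, (indeg_from A1 j <= indeg_from A1 i)%N]].

End Degrees.

Definition digraph_class := forall n : nat, digraph n -> Prop.

Definition Gplus : digraph_class := fun n G =>
  forall i : 'I_n, exists j : 'I_n, (i, j) \in edges G.

Section Probability.
Variable R : realFieldType.

Definition is_pmf (T : finType) (p : T -> R) : Prop :=
  (forall x, 0 <= p x) /\ \sum_x p x = 1.

Definition uniform (T : finType) (S : {set T}) (x : T) : R :=
  if x \in S then #|S|%:R^-1 else 0.

Definition expectation (T : finType) (p : T -> R) (X : T -> R) : R :=
  \sum_x p x * X x.

Lemma uniform_pmf (T : finType) (S : {set T}) :
  S != set0 -> is_pmf (uniform S).
Proof.
move=> S0; split=> [x|].
  by rewrite /uniform; case: ifP => // _; rewrite invr_ge0 ler0n.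
rewrite /uniform -big_mkcond /= sumr_const -[_ *+ #|S|]mulr_natl mulfV //.
by rewrite pnatr_eq0 cards_eq0.
Qed.

(* A randomized mechanism maps each graph to the law of the selected vertex. *)
Record mechanism := Mechanism {
  law :> forall n : nat, digraph n -> 'I_n -> R;
  law_pmf : forall (n : nat) (G : digraph n), (0 < n)%N -> is_pmf (law G)
}.

Definition alpha_optimal (alpha : R) (f : mechanism) (C : digraph_class)
    : Prop :=
  forall (n : nat) (G : digraph n), (0 < n)%N -> C n G ->
    (0 < max_indeg G)%N ->
    alpha * (max_indeg G)%:R <= expectation (f n G) (fun i => (indeg G i)%:R).

Section TwoPartition.
Variables (n : nat) (G : digraph n).

(* An assignment a sends i to A_2 when a i is true and to A_1 otherwise. *)
Definition part1 (a : {ffun 'I_n -> bool}) : {set 'I_n} := [set i | ~~ a i].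
Definition part2 (a : {ffun 'I_n -> bool}) : {set 'I_n} := [set i | a i].

(* Law of n independent assignments, each uniform on the two parts. *)
Definition assignment_law (a : {ffun 'I_n -> bool}) : R :=
  \prod_(i < n) uniform [set: bool] (a i).

Definition selection_law (a : {ffun 'I_n -> bool}) : 'I_n -> R :=
  if part2 a == set0 then uniform [set: 'I_n]
  else uniform (argmax_indeg G (part1 a) (part2 a)).

Definition two_partition_law (i : 'I_n) : R :=
  \sum_(a : {ffun 'I_n -> bool}) assignment_law a * selection_law a i.

Lemma assignment_law_pmf : is_pmf assignment_law.
Proof.
have [u0 u1] : is_pmf (@uniform bool [set: bool]).
  by apply: uniform_pmf; apply/set0Pn; exists true; rewrite inE.
split=> [a|]; first by apply: prodr_ge0 => i _; apply: u0.
rewrite /assignment_law.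
rewrite -(bigA_distr_bigA (fun (_ : 'I_n) b => uniform [set: bool] b)).
by rewrite big1.
Qed.

Lemma argmax_indeg_neq0 (A1 A2 : {set 'I_n}) :
  A2 != set0 -> argmax_indeg G A1 A2 != set0.
Proof.
case/set0Pn=> i0 i0A; apply/set0Pn.
case: (@arg_maxnP _ i0 (mem A2) (indeg_from G A1) i0A) => i iA imax.
by exists i; rewrite inE; apply/andP; split=> //; apply/forall_inP.
Qed.

Lemma selection_law_pmf (a : {ffun 'I_n -> bool}) :
  (0 < n)%N -> is_pmf (selection_law a).
Proof.
move=> n_gt0; rewrite /selection_law; case: ifPn => [_|A20].
  by apply: uniform_pmf; apply/set0Pn; exists (Ordinal n_gt0); rewrite inE.
exact/uniform_pmf/argmax_indeg_neq0.
Qed.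

Lemma two_partition_law_pmf : (0 < n)%N -> is_pmf two_partition_law.
Proof.
move=> n_gt0; have [q0 q1] := assignment_law_pmf.
split=> [i|].
  apply: sumr_ge0 => a _; apply: mulr_ge0; first exact: q0.
  exact: (selection_law_pmf a n_gt0).1.
rewrite exchange_big -[RHS]q1; apply: eq_bigr => a _ /=.
by rewrite -mulr_sumr (selection_law_pmf a n_gt0).2 mulr1.
Qed.

End TwoPartition.

Definition two_partition : mechanism := Mechanism two_partition_law_pmf.

End Probability.

(* Main.v *)
Require Import Defs.
From mathcomp Require Import all_boot all_order all_algebra.
From mathcomp Require Import zify lra.
Local Open Scope ring_scope.

(** Let [u] have maximum indegree [D], and let [X] be its indegree from [A_1].
    Pair every assignment with the one obtained by moving [u] to the other part;
    this does not change [X].  If, with [u] in [A_2], every competitor has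
    indegree from [A_1] below [X], then [u] is selected, with indegree [D].
    Otherwise some competitor reaches [X], and does so on both sides of the
    pair, so the two selected vertices both have indegree at least [X].  The
    mechanism thus obtains at least [E[min(D, 2X)] / 2].

    If [D >= 2], write [T = D - X].  The bound
    [D(D-1) <= min(D, 2X)(D-1) + T(T-1)] holds pointwise, and pairwise
    independence gives [E[T(T-1)] = D(D-1)/4], hence [E[min(D, 2X)] >= 3D/4].
    If [D = 1], outdegrees at least 1 force all indegrees to be exactly 1. *)

Set Implicit Arguments.
Unset Strict Implicit.
Unset Printing Implicit Defensive.

Import Order.TTheory GRing.Theory Num.Theory.

Section Flip.
Variable n : nat.
Implicit Types (a : {ffun 'I_n -> bool}) (i j k : 'I_n) (D : {set 'I_n}).

Definition flip i a : {ffun 'I_n -> bool} := [ffun j => (j == i) (+) a j].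

Lemma flipK i : involutive (flip i).
Proof. by move=> a; apply/ffunP => j; rewrite !ffunE addbA addbb. Qed.

Lemma sum_flip (V : nmodType) i (F : {ffun 'I_n -> bool} -> V) :
  \sum_a F (flip i a) = \sum_a F a.
Proof. by rewrite [RHS](reindex_inj (inv_inj (flipK i))). Qed.

(** Exactly one of [a] and [flip i a] puts [i] in the second part. *)
Lemma sum_assignment i : (2 * \sum_(a : {ffun 'I_n -> bool}) a i = 2 ^ n)%N.
Proof.
have E : (\sum_a flip i a i = \sum_(a : {ffun 'I_n -> bool}) a i)%N.
  exact: (sum_flip i (fun a => a i : nat)).
rewrite mul2n -addnn -{1}E -big_split /=.
rewrite (eq_bigr (fun=> 1%N)) => [|a _]; last first.
  by rewrite ffunE eqxx; case: (a i).
by rewrite sum1_card card_ffun card_bool card_ord.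
Qed.

(** Pairwise independence: flipping [j] keeps [a i], so the two values of [a i * a j] add up to
    [a i], and the sum is half of the previous one. *)
Lemma sum_assignment2 i j : i != j -> (4 * \sum_(a : {ffun 'I_n -> bool}) a i * a j = 2 ^ n)%N.
Proof.
move=> ij; rewrite -(sum_assignment i) -[4%N]/(2 * 2)%N -mulnA; congr (_ * _)%N.
have E : (\sum_a (flip j a i * flip j a j) =
            \sum_(a : {ffun 'I_n -> bool}) a i * a j)%N.
  exact: (sum_flip j (fun a => a i * a j)%N).
rewrite mul2n -addnn -{1}E -big_split /=; apply: eq_bigr => a _.
by rewrite !ffunE eqxx (negPf ij); case: (a i) (a j) => [] [].
Qed.

(** The product counts ordered pairs of distinct elements of [D] that both lie in the second part;
    each pair does so in a quarter of the assignments. *)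
Lemma sum_falling_factorial2 D :
  (4 * \sum_(a : {ffun 'I_n -> bool})
      ((\sum_(i in D) a i) * (\sum_(i in D) a i).-1)
     = #|D| * #|D|.-1 * 2 ^ n)%N.
Proof.
have E a : ((\sum_(i in D) a i) * (\sum_(i in D) a i).-1 =
            \sum_(i in D) \sum_(j in D :\ i) a i * a j)%N.
  rewrite big_distrl /=; apply: eq_bigr => i iD.
  rewrite -big_distrr /=; case ai: (a i); rewrite ?mul0n // !mul1n.
  by rewrite (big_setD1 i iD) /= ai.
rewrite (eq_bigr _ (fun a _ => E a)) exchange_big big_distrr /=.
rewrite -mulnA -sum_nat_const; apply: eq_bigr => i iD.
rewrite exchange_big big_distrr /= [#|D|](cardsD1 i) iD /= -sum_nat_const.
apply: eq_bigr => j; rewrite !inE => /andP[ji _].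
by rewrite sum_assignment2 // eq_sym.
Qed.

Lemma sum_part2_part1 D a :
  (\sum_(i in D) a i + #|[set j in part1 a | j \in D]| = #|D|)%N.
Proof.
rewrite -(cardsID [set j | a j] D) -!sum1_card; congr (_ + _)%N.
  rewrite [RHS](eq_bigl (fun j => (j \in D) && a j)) => [|j]; last first.
    by rewrite !inE.
  by rewrite big_mkcondr; apply: eq_bigr => j _; case: (a j).
by apply: eq_bigl => i; rewrite !inE.
Qed.

(* The pointwise bound compares [min(|D|, 2X)(|D|-1)] with
   [|D|(|D|-1) - T(T-1)], the sum of [min(2, 2 |P \cap A_1|)] over all
   unordered pairs [P] in [D]. *)
Lemma sum_minn_part1 D : (1 < #|D|)%N ->
  (3 * #|D| * 2 ^ n <=
     4 * \sum_a minn #|D| (2 * #|[set j in part1 a | j \in D]|))%N.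
Proof.
move=> D2; rewrite -(@leq_pmul2r #|D|.-1); last by lia.
set s := (\sum_a _)%N.
have : (\sum_(a : {ffun 'I_n -> bool}) #|D| * #|D|.-1 <=
        s * #|D|.-1 + \sum_(a : {ffun 'I_n -> bool})
          ((\sum_(i in D) a i) * (\sum_(i in D) a i).-1))%N.
  rewrite /s big_distrl -big_split /=; apply: leq_sum => a _.
  have := sum_part2_part1 D a.
  move: (\sum_(i in D) a i)%N #|[set j in _ | _]| => t x.
  move: #|D| D2 => [|d] //= D2 E.
  rewrite minnC /minn; case: ltnP => _; first last.
    by rewrite leq_addr.
  case: t E => [|t] E /=; first nia.
  have -> : d = (t + x)%N by lia.
  (* The right side exceeds the left by [x * x - x], which is nonnegative because [x] is a natural
     number. *)
  case: x {E}; nia.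
rewrite big_const iter_addn_0 card_ffun card_bool card_ord.
have := sum_falling_factorial2 D.
move: (\sum_a (_ * _))%N (2 ^ n)%N #|D|.-1 => q N e; nia.
Qed.

End Flip.

Lemma expectation_ge (R : realFieldType) (T : finType) (p X : T -> R) (c : R) :
  is_pmf p -> (forall x, p x != 0 -> c <= X x) -> c <= expectation p X.
Proof.
move=> [p0 p1] cX; rewrite -[c]mul1r -p1 mulr_suml; apply: ler_sum => x _.
have [->|px] := eqVneq (p x) 0; first by rewrite !mul0r.
by rewrite ler_wpM2l // cX.
Qed.

Section TwoPartition.
Variables (R : realFieldType) (n : nat) (G : digraph n).
Implicit Types (a : {ffun 'I_n -> bool}) (i j u : 'I_n).

Definition selected_indeg a : R :=
  expectation (selection_law R G a) (fun i => (indeg G i)%:R).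

Lemma indeg_from_le (S S' : {set 'I_n}) i :
  S \subset S' -> (indeg_from G S i <= indeg_from G S' i)%N.
Proof.
move=> /subsetP SS'; apply/subset_leq_card/subsetP => j.
by rewrite !inE => /andP[/SS' -> ->].
Qed.

Lemma selected_indeg_ge (c : nat) a : (0 < n)%N -> part2 a != set0 ->
  (forall i, i \in argmax_indeg G (part1 a) (part2 a) -> c <= indeg G i)%N ->
  c%:R <= selected_indeg a.
Proof.
move=> n0 a2 cG; apply: expectation_ge; first exact: selection_law_pmf.
move=> i; rewrite /selection_law (negPf a2) /uniform.
by case: ifP => [ia _|_]; rewrite ?eqxx // ler_nat cG.
Qed.

Lemma selected_indeg_part2 a j : j \in part2 a ->
  (indeg_from G (part1 a) j)%:R <= selected_indeg a.
Proof.
move=> ja; apply: selected_indeg_ge => [||i]; first by case: (j) => m /=; lia.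
  by apply/set0Pn; exists j.
rewrite inE => /andP[_ /forall_inP/(_ j ja)] /leq_trans; apply.
by apply: indeg_from_le; apply: subsetT.
Qed.

Lemma selected_indeg_flip_part2 u a : a u ->
  (minn (indeg G u) (2 * indeg_from G (part1 a) u))%:R
    <= selected_indeg a + selected_indeg (flip u a).
Proof.
move=> au; have ua : u \in part2 a by rewrite inE.
have n0 : (0 < n)%N by case: (u) => m /=; lia.
have S0 b : 0 <= selected_indeg b.
  by apply: expectation_ge => //; apply: selection_law_pmf.
have [/exists_inP[j] | Hlt] := boolP [exists j in part2 a :\ u,
  indeg_from G (part1 a) u <= indeg_from G (part1 a) j]%N.
  rewrite !inE => /andP[ju aj] uj.
  apply: le_trans (_ : (2 * indeg_from G (part1 a) u)%:R <= _).
    by rewrite ler_nat geq_minr.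
  rewrite mul2n -addnn natrD; apply: lerD.
    exact: selected_indeg_part2.
  apply: le_trans (selected_indeg_part2 (j := j) _); last first.
    by rewrite inE ffunE (negPf ju).
  (* Moving [u] out of the second part only enlarges the first, so the indegree of [j] from it
     cannot drop. *)
  rewrite ler_nat; apply: leq_trans uj _; apply: indeg_from_le.
  by apply/subsetP => i; rewrite !inE ffunE; case: eqVneq => [->|]; rewrite ?au.
apply: le_trans (_ : (indeg G u)%:R <= _); first by rewrite ler_nat geq_minl.
rewrite -[leLHS]addr0; apply: lerD => //.
apply: selected_indeg_ge => // [|i]; first by apply/set0Pn; exists u.
rewrite !inE => /andP[ai /forall_inP/(_ u ua) ui].
(* A maximizer other than [u] would be a competitor reaching [u]; hence no tie is possible and [u]
   is selected. *)
have [->//|iu] := eqVneq i u; case/negP: Hlt; apply/exists_inP; exists i => //.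
by rewrite !inE iu.
Qed.

(** Only [u] changes parts, and without a loop it does not count towards its own indegree. *)
Lemma indeg_from_flip u a :
  indeg_from G (part1 (flip u a)) u = indeg_from G (part1 a) u.
Proof.
apply: eq_card => j; rewrite !inE ffunE; case: eqVneq => [->|//].
by rewrite (negPf (loopless G u)) !andbF.
Qed.

Lemma selected_indeg_flip u a :
  (minn (indeg G u) (2 * indeg_from G (part1 a) u))%:R
    <= selected_indeg a + selected_indeg (flip u a).
Proof.
case au: (a u); first exact: selected_indeg_flip_part2.
have := @selected_indeg_flip_part2 u (flip u a).
by rewrite flipK indeg_from_flip addrC; apply; rewrite ffunE eqxx au.
Qed.

Lemma assignment_lawE a : assignment_law R a = (2 ^ n)%:R^-1.
Proof.
rewrite /assignment_law (eq_bigr (fun=> 2%:R^-1)) => [|i _].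
  by rewrite prodr_const card_ord natrX exprVn.
by rewrite /uniform inE cardsT card_bool.
Qed.

Lemma expectation_two_partition :
  expectation (two_partition R n G) (fun i => (indeg G i)%:R) =
  (2 ^ n)%:R^-1 * \sum_a selected_indeg a.
Proof.
rewrite /expectation /= /two_partition_law mulr_sumr.
rewrite (eq_bigr (fun i => \sum_a
  assignment_law R a * selection_law R G a i * (indeg G i)%:R)) => [|i _].
  rewrite exchange_big /=; apply: eq_bigr => a _; rewrite mulr_sumr.
  by apply: eq_bigr => i _; rewrite assignment_lawE mulrA.
by rewrite mulr_suml.
Qed.

Lemma two_partition_indeg_ge u : (1 < indeg G u)%N ->
  3%:R / 8%:R * (indeg G u)%:R <=
    expectation (two_partition R n G) (fun i => (indeg G i)%:R).
Proof.
move=> u2; pose D := [set j | (j, u) \in edges G].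
have DE (S : {set 'I_n}) : indeg_from G S u = #|[set j in S | j \in D]|.
  by apply: eq_card => j; rewrite !inE.
have D1 : indeg G u = #|D|.
  by rewrite /indeg DE; apply: eq_card => j; rewrite !inE.
rewrite expectation_two_partition [leRHS]mulrC ler_pdivlMr ?ltr0n ?expn_gt0 //.
have := sum_minn_part1 (D := D); rewrite -D1 => /(_ u2).
rewrite -(ler_nat R) !natrM natr_sum.
have : \sum_a (minn (indeg G u) (2 * #|[set j in part1 a | j \in D]|))%:R <=
       2 * \sum_a selected_indeg a.
  (* One of the two copies of the sum is reindexed by the flip of [u], so that the paired bound
     applies termwise. *)
  rewrite mulr_natl mulr2n -{2}(sum_flip u selected_indeg) -big_split /=.
  by apply: ler_sum => a _; rewrite -DE; apply: selected_indeg_flip.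
lra.
Qed.

(** Choose an out-neighbour [f j] of each [j]. A collision would give a vertex of indegree 2, so [f]
    is injective, hence bijective, and each vertex has an in-neighbour. *)
Lemma indeg_gt0_of_max_indeg_le1 i :
  Gplus G -> (max_indeg G <= 1)%N -> (0 < indeg G i)%N.
Proof.
move=> /fin_all_exists[f fP] G1.
have f_inj : injective f.
  move=> j k fjk; apply/eqP; move: G1; apply: contraTT => jk; rewrite -ltnNge.
  apply: leq_trans (bigop.leq_bigmax (f j)).
  have -> : (2 = #|[set j; k]|)%N by rewrite cards2 jk.
  apply/subset_leq_card/subsetP => l; rewrite !inE.
  by case/orP => /eqP->; rewrite ?fP // fjk fP.
have [g _ fg] := injF_bij f_inj.
by apply/card_gt0P; exists (g i); rewrite !inE -{2}(fg i) fP.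
Qed.

End TwoPartition.

Theorem mainTheorem7 (R : realFieldType) :
  alpha_optimal (3%:R / 8%:R) (two_partition R) Gplus.
Proof.
move=> n G n0 GP G0.
have [|u uE] := @bigop.eq_bigmax _ (indeg G); first by rewrite card_ord.
rewrite -/(max_indeg G) in uE.
have [G1|G2] := leqP (max_indeg G) 1; last first.
  by rewrite uE in G2 *; apply: two_partition_indeg_ge.
apply: (@le_trans _ _ 1).
  have -> : max_indeg G = 1%N by apply/eqP; rewrite eqn_leq G1.
  lra.
apply: expectation_ge => [|i _]; first exact: law_pmf.
by rewrite ler1n indeg_gt0_of_max_indeg_le1.
Qed.
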